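(* The $\mathcal{B}$-Index polynomial is zero for all virtual knots: if $D$ is an oriented virtual knot diagram (i.e. an oriented twisted knot diagram without bars), then $\mathcal{B}_D(t)=0$.
   Context: Twisted diagrams. A twisted link diagram is a generic immersion of circles in the plane in which every double point is either a classical crossing (with over/under information) or a virtual crossing, together with finitely many bars (short transverse marks) placed on edges away from the crossings. A twisted knot diagram has one circle; a virtual knot diagram is a twisted knot diagram with no bars. Sign. $\operatorname{sgn}(c)=+1$ if the under-strand direction is obtained from the over-strand direction by a counterclockwise rotation by an angle less than $\pi$, and $-1$ otherwise. Arcs. In an oriented diagram, a component with at most one bar is regarded as a single arc; otherwise the arcs of a component are its segments between two consecutive bars. For an arc $C$, $\langle C=C_1,\dots,C_n\rangle$ denotes the sequence of all arcs of the component containing $C$, in the order met when travelling along the orientation starting from $C$. Linking sets. In a two-component oriented diagram $L$, a linking crossing is a classical crossing between different components. For an arc $C$, $\mathcal{O}(C)$ (resp. $\mathcal{U}(C)$) is the set of linking crossings met as overcrossings (resp. undercrossings) when traversing $C$. With $\langle C=C_1,\dots,C_n\rangle$ the sequence of all arcs of the component of $L$ containing $C$, in the order met when travelling along the orientation starting from $C$, $\mathcal{O}_L(L:C)=\mathcal{O}(C_1)\cup\mathcal{U}(C_2)\cup\mathcal{O}(C_3)\cup\cdots$ and $\mathcal{U}_L(L:C)=\mathcal{U}(C_1)\cup\mathcal{O}(C_2)\cup\mathcal{U}(C_3)\cup\cdots$, alternating through $C_n$. Indices. Let $c$ be a classical crossing of an oriented twisted knot diagram $D$. Put a base point $\alpha$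 on the incoming part of the under strand and a base point $\beta$ on the incoming part of the over strand, both immediately before $c$. Smoothing $c$ along the orientation (incoming under strand joined to outgoing over strand, incoming over strand joined to outgoing under strand) gives an oriented two-component diagram $D_c$. Let $C$, $C'$ be the arcs of $D_c$ containing $\alpha$, $\beta$ respectively. Then $\operatorname{Ind}^1(c)=\sum_{x\in\mathcal{O}_L(D_c:C)}\operatorname{sgn}(x)-\sum_{x\in\mathcal{U}_L(D_c:C)}\operatorname{sgn}(x)$, and $\operatorname{Ind}^2(c)$ is the same expression with $C'$ in place of $C$. $\mathcal{B}$-Index polynomial. $\mathcal{B}_D(t)=\sum_{c\in\mathcal{C}(D)}\operatorname{sgn}(c)\left(t^{\operatorname{Ind}^1(c)+\operatorname{Ind}^2(c)}-1\right)$, where $\mathcal{C}(D)$ is the set of classical crossings of $D$. *)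

(* Defs.v *)
From HB Require Import structures.
From mathcomp Require Import all_boot all_order all_algebra.
From mathcomp Require Import all_classical all_reals all_analysis.

Set Implicit Arguments.
Unset Strict Implicit.
Unset Printing Implicit Defensive.

Import Order.TTheory GRing.Theory Num.Theory.
Import numFieldNormedType.Exports.

Local Open Scope ring_scope.

(** A circle is R/Z, with fundamental domain [0, 1[ and oriented by increasing
    parameter; the pair (i, t) is the point of parameter t on the i-th circle.
    Circle i is immersed by the 1-periodic map t |-> (xcoord i t, ycoord i t). *)

Definition on_circle (R : realType) (m : nat) (p : 'I_m * R) : bool :=
  0 <= p.2 < 1.

Definition smooth (R : realType) (f : R -> R) : Prop :=
  forall (n : nat) (t : R), derivable (derive1n n f) t 1.

Definition plane_point (R : realType) (m : nat) (x y : 'I_m -> R -> R)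
    (p : 'I_m * R) : R * R :=
  (x p.1 p.2, y p.1 p.2).

Definition plane_velocity (R : realType) (m : nat) (x y : 'I_m -> R -> R)
    (p : 'I_m * R) : R * R :=
  (derive1 (x p.1) p.2, derive1 (y p.1) p.2).

Definition double_pair (R : realType) (m : nat) (x y : 'I_m -> R -> R)
    (p q : 'I_m * R) : Prop :=
  [/\ on_circle p, on_circle q, p <> q
    & plane_point x y p = plane_point x y q].

(** The classical crossings are a labelled part of the double points, each with
    a choice of which preimage is the over one; all the other double points are
    the virtual crossings, which carry no further information. *)
Record twisted_diagram (R : realType) (m : nat) := TwistedDiagram {
  xcoord : 'I_m -> R -> R;
  ycoord : 'I_m -> R -> R;
  crossing : finType;
  over : crossing -> 'I_m * R;
  under : crossing -> 'I_m * R;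
  bars : seq ('I_m * R);
  xcoord_smooth : forall i, smooth (xcoord i);
  ycoord_smooth : forall i, smooth (ycoord i);
  xcoord_periodic : forall i t, xcoord i (t + 1) = xcoord i t;
  ycoord_periodic : forall i t, ycoord i (t + 1) = ycoord i t;
  immersed : forall p, plane_velocity xcoord ycoord p <> (0, 0);
  double_points_finite :
    finite_set [set z : R * R | exists p q,
      double_pair xcoord ycoord p q /\ plane_point xcoord ycoord p = z]%classic;
  no_triple_point : forall p q r,
    double_pair xcoord ycoord p q -> double_pair xcoord ycoord p r -> q = r;
  double_points_transverse : forall p q, double_pair xcoord ycoord p q ->
    let u := plane_velocity xcoord ycoord p in
    let v := plane_velocity xcoord ycoord q in
    u.1 * v.2 - u.2 * v.1 != 0;
  crossing_double : forall c, double_pair xcoord ycoord (over c) (under c);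
  crossing_inj : injective (fun c => plane_point xcoord ycoord (over c));
  bars_on_circle : forall b, b \in bars -> on_circle b;
  bars_uniq : uniq bars;
  bars_off_crossings :
    forall b q, b \in bars -> ~ double_pair xcoord ycoord b q
}.

Definition twisted_knot_diagram (R : realType) := twisted_diagram R 1.

Definition is_virtual (R : realType) (D : twisted_knot_diagram R) : Prop :=
  bars D = [::].

Definition rotate (R : realType) (theta : R) (u : R * R) : R * R :=
  (cos theta * u.1 - sin theta * u.2, sin theta * u.1 + cos theta * u.2).

(** The factor k is there because a direction is a nonzero vector up to
    positive scaling. *)
Definition ccw (R : realType) (u v : R * R) : Prop :=
  exists theta k : R,
    [/\ 0 < theta < pi, 0 < k
      & v = (k * (rotate theta u).1, k * (rotate theta u).2)].

Definition sgn (R : realType) (m : nat) (D : twisted_diagram R m)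
    (c : crossing D) : int :=
  if `[< ccw (plane_velocity (xcoord D) (ycoord D) (over c))
             (plane_velocity (xcoord D) (ycoord D) (under c)) >]
  then 1 else -1.

(** Arcs, smoothings and linking sets see a diagram only through the order in
    which each component meets its classical crossings and bars. *)

Inductive passage (C : Type) := Over of C | Under of C | Bar.
Arguments Bar {C}.

Definition passage_code (C : Type) (e : passage C) : option (bool * C) :=
  match e with
  | Over c => Some (true, c)
  | Under c => Some (false, c)
  | Bar => None
  end.

Definition passage_decode (C : Type) (o : option (bool * C)) : passage C :=
  match o with
  | Some (true, c) => Over c
  | Some (false, c) => Under c
  | None => Bar
  end.

Lemma passage_codeK (C : Type) :
  cancel (@passage_code C) (@passage_decode C).
Proof. by case. Qed.

HB.instance Definition _ (C : eqType) :=
  Equality.copy (passage C) (can_type (@passage_codeK C)).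

(** [G i] is the cyclic word of passages of component i, cut open at some base
    point of that component. *)
Definition gauss_code (C : Type) (m : nat) := 'I_m -> seq (passage C).

Definition passages (R : realType) (m : nat) (D : twisted_diagram R m) :
    seq (('I_m * R) * passage (crossing D)) :=
  [seq (over c, Over c) | c <- enum (crossing D)]
  ++ [seq (under c, Under c) | c <- enum (crossing D)]
  ++ [seq (b, Bar) | b <- bars D].

Definition gauss_code_of (R : realType) (m : nat) (D : twisted_diagram R m) :
    gauss_code (crossing D) m :=
  fun i => [seq e.2 | e <- sort (fun e f => e.1.2 <= f.1.2)
                              [seq e <- passages D | e.1.1 == i]].

(** The part of the cyclic word [w] strictly between the letters [e] and [f]
    ([arc w e f] runs cyclically from [e], included, to [f], excluded). *)
Definition strictly_between (C : eqType) (w : seq (passage C))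
    (e f : passage C) : seq (passage C) :=
  behead (arc w e f).

(** Smoothing of the one-component code [w] at [c]. Component 0 is cut open at
    alpha: just after alpha it switches from the incoming under strand to the
    outgoing over strand, and it comes back to alpha along the incoming under
    strand. Likewise component 1 is cut open at beta. *)
Definition smoothing (C : eqType) (w : seq (passage C)) (c : C) :
    gauss_code C 2 :=
  fun i => if i == ord0 then strictly_between w (Over c) (Under c)
           else strictly_between w (Under c) (Over c).

Fixpoint cut_at_bars (C : Type) (w : seq (passage C)) :
    seq (passage C) * seq (seq (passage C)) :=
  match w with
  | [::] => ([::], [::])
  | Bar :: w' => let s := cut_at_bars w' in ([::], s.1 :: s.2)
  | e :: w' => let s := cut_at_bars w' in (e :: s.1, s.2)
  end.

(** The sequence of all arcs of the component with word [w], starting from the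
    arc that contains the base point of [w]. If [w] is w0 Bar w1 ... Bar wk with
    k > 0, that arc is wk ++ w0, and it is followed by w1, ..., w(k-1). *)
Definition arcs_from_base (C : Type) (w : seq (passage C)) :
    seq (seq (passage C)) :=
  let: (w0, ws) := cut_at_bars w in
  if ws is [::] then [:: w0]
  else (last w0 ws ++ w0) :: behead (belast w0 ws).

Definition linking (C : finType) (L : gauss_code C 2) (x : C) : bool :=
  [exists i : 'I_2, exists j : 'I_2,
     [&& i != j, Over x \in L i & Under x \in L j]].

Definition over_set (C : finType) (L : gauss_code C 2)
    (a : seq (passage C)) : {set C} :=
  [set x | linking L x & Over x \in a].

Definition under_set (C : finType) (L : gauss_code C 2)
    (a : seq (passage C)) : {set C} :=
  [set x | linking L x & Under x \in a].

(** [alternating_set L true s] is O(C1) U U(C2) U O(C3) U ... for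
    [s] = C1, C2, C3, ...; with [false] it starts with U(C1). *)
Fixpoint alternating_set (C : finType) (L : gauss_code C 2) (b : bool)
    (s : seq (seq (passage C))) : {set C} :=
  if s is a :: s' then
    (if b then over_set L a else under_set L a)
      :|: alternating_set L (~~ b) s'
  else finset.set0.

(** The sets O_L(L : C) and U_L(L : C) for C the arc that contains the base
    point of component [i]. *)
Definition over_linking_set (C : finType) (L : gauss_code C 2) (i : 'I_2) :
    {set C} :=
  alternating_set L true (arcs_from_base (L i)).

Definition under_linking_set (C : finType) (L : gauss_code C 2) (i : 'I_2) :
    {set C} :=
  alternating_set L false (arcs_from_base (L i)).

Definition smoothed_code (R : realType) (D : twisted_knot_diagram R)
    (c : crossing D) : gauss_code (crossing D) 2 :=
  smoothing (gauss_code_of D ord0) c.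

(** The smoothing keeps all orientations, so a crossing of D_c has the same sign
    as in D. *)
Definition index_at (R : realType) (D : twisted_knot_diagram R)
    (c : crossing D) (i : 'I_2) : int :=
  (\sum_(x in over_linking_set (smoothed_code c) i) sgn x)
  - (\sum_(x in under_linking_set (smoothed_code c) i) sgn x).

Definition Ind1 (R : realType) (D : twisted_knot_diagram R)
    (c : crossing D) : int :=
  index_at c ord0.

Definition Ind2 (R : realType) (D : twisted_knot_diagram R)
    (c : crossing D) : int :=
  index_at c ord_max.

(** Laurent polynomials over Z are taken inside the fraction field of Z[t]. *)
Definition B_index_polynomial (R : realType) (D : twisted_knot_diagram R) :
    {fraction {poly int}} :=
  let t : {fraction {poly int}} := tofrac 'X in
  \sum_(c : crossing D) (t ^ (Ind1 c + Ind2 c) - 1) *~ sgn c.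

(* Main.v *)
Require Import Defs.
From mathcomp Require Import all_boot all_order all_algebra.
From mathcomp Require Import all_classical all_reals all_analysis.

Set Implicit Arguments.
Unset Strict Implicit.
Unset Printing Implicit Defensive.

Import GRing.Theory.

(** Without bars each component of D_c is a single arc, so Ind^1(c) is the signed
    number of linking crossings where the first component passes over minus that
    where it passes under. A linking crossing is over on one component exactly
    when it is under on the other, so Ind^2(c) = - Ind^1(c) and every term of
    B_D(t) vanishes. *)

Lemma arcs_from_base_barless (C : eqType) (w : seq (passage C)) :
  Bar \notin w -> arcs_from_base w = [:: w].
Proof.
move=> nb; rewrite /arcs_from_base.
suff -> : cut_at_bars w = (w, [::]) by [].
elim: w nb => //= e w IH; rewrite inE negb_or => /andP[ne /IH {IH}].
by case: e ne => [c|c|] //= _ ->.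
Qed.

Lemma barless_over_linking_set (C : finType) (L : gauss_code C 2) (i : 'I_2) :
  Bar \notin L i -> over_linking_set L i = over_set L (L i).
Proof.
by move=> nb; rewrite /over_linking_set arcs_from_base_barless //= finset.setU0.
Qed.

Lemma barless_under_linking_set (C : finType) (L : gauss_code C 2) (i : 'I_2) :
  Bar \notin L i -> under_linking_set L i = under_set L (L i).
Proof.
by move=> nb; rewrite /under_linking_set arcs_from_base_barless //= finset.setU0.
Qed.

(** A linking crossing has its two passages on different components. Since the components share no
    letter, being over on [i] is the same as being under on [j]. *)
Lemma over_set_other (C : finType) (L : gauss_code C 2) (i j : 'I_2) :
  i != j -> ~~ has (mem (L i)) (L j) -> over_set L (L i) = under_set L (L j).
Proof.
move=> nij /hasPn dij.
have two (a b : 'I_2) : a != b -> (a == i) && (b == j) || (a == j) && (b == i).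
  by case: a b i j nij {dij} => [[|[]]//= ?] [[|[]]//= ?] [[|[]]//= ?] [[|[]]//= ?].
apply/setP => x; rewrite !inE; case: (boolP (linking L x)) => //=.
case/existsP=> a /existsP[b /and3P[/two + oa ub]].
case/orP=> /andP[/eqP ea /eqP eb]; subst a b; first by rewrite oa ub.
(* Here [x] is over on [j] and under on [i]; disjointness then keeps it out of both sets. *)
have /negbTE -> : Over x \notin L i by exact: dij oa.
by apply/esym/negbTE/negP => /dij; rewrite /= ub.
Qed.

(** Up to rotation [w] reads [Over c :: p ++ Under c :: q], and the components are [p] and [q], so
    uniqueness of letters separates them. *)
Lemma smoothing_disjoint (C : eqType) (w : seq (passage C)) (c : C) :
  uniq w -> Over c \in w -> Under c \in w ->
  ~~ has (mem (smoothing w c ord0)) (smoothing w c ord_max).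
Proof.
move=> uw ow uw'; rewrite /smoothing /= /strictly_between.
have [//|i p q <- <- rw] := rot_to_arc uw ow uw'.
have: uniq (rot i w) by rewrite rot_uniq.
rewrite rw -cat_cons cat_uniq => /and3P[_ /hasPn d _].
by apply/hasPn => x /mem_behead /d; apply: contra => /mem_behead.
Qed.

(** Serves to carry the absence of bars over to the smoothed components. *)
Lemma mem_smoothing (C : eqType) (w : seq (passage C)) (c : C) i :
  uniq w -> Over c \in w -> Under c \in w -> {subset smoothing w c i <= w}.
Proof.
move=> uw ow uw' x.
rewrite /smoothing /strictly_between.
have [//|k p q <- <- rw] := rot_to_arc uw ow uw'.
rewrite -(mem_rot k w) rw -cat_cons mem_cat.
by case: ifP => _ /mem_behead ->; rewrite ?orbT.
Qed.

(** The order of the letters along the circle can be forgotten: only membership and uniqueness are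
    read off below. *)
Lemma perm_gauss_code_virtual (R : realType) (D : twisted_knot_diagram R) :
  is_virtual D ->
  perm_eq (gauss_code_of D ord0)
    ([seq Over c | c <- enum (crossing D)]
     ++ [seq Under c | c <- enum (crossing D)]).
Proof.
move=> vD; rewrite /gauss_code_of.
have -> : [seq e <- passages D | e.1.1 == ord0] = passages D.
  by apply/all_filterP/allP => e _; rewrite (ord1 e.1.1).
apply: perm_trans (perm_map _ (permEl (perm_sort _ _))) _.
by rewrite /passages vD /= cats0 map_cat -!map_comp.
Qed.

Lemma gauss_code_virtual (R : realType) (D : twisted_knot_diagram R)
    (w := gauss_code_of D ord0) : is_virtual D ->
  [/\ uniq w, Bar \notin w & forall c, Over c \in w /\ Under c \in w].
Proof.
move=> /perm_gauss_code_virtual pw; split.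
- rewrite (perm_uniq pw) cat_uniq; apply/and3P; split.
  + by rewrite map_inj_uniq ?enum_uniq // => ? ? [].
  + by apply/hasPn => _ /mapP[c _ ->]; apply/mapP => -[].
  + by rewrite map_inj_uniq ?enum_uniq // => ? ? [].
- rewrite (perm_mem pw) mem_cat negb_or.
  by apply/andP; split; apply/mapP => -[].
- move=> c; rewrite !(perm_mem pw) !mem_cat.
  by split; apply/orP; [left|right]; apply: map_f; rewrite mem_enum.
Qed.

Lemma Ind_virtual (R : realType) (D : twisted_knot_diagram R) (c : crossing D) :
  is_virtual D -> (Ind1 c + Ind2 c = 0)%R.
Proof.
move=> /gauss_code_virtual[uw nb /(_ c)[ow uc]].
have nbL i : Bar \notin smoothed_code c i.
  by apply: contra nb; apply: mem_smoothing.
have d := smoothing_disjoint uw ow uc.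
rewrite /Ind1 /Ind2 /index_at !barless_over_linking_set //.
rewrite !barless_under_linking_set // (@over_set_other _ _ ord0 ord_max) //.
rewrite (@over_set_other _ _ ord_max ord0) //; last by rewrite has_sym.
(* With [u0], [u1] the signed sums over the undercrossing sets of the two components, the goal is
   [(u1 - u0) + (u0 - u1) = 0]. *)
by rewrite addrC subrKA subrr.
Qed.

Theorem mainTheorem8 (R : realType) (D : twisted_knot_diagram R)
  (D_virtual : is_virtual D) : B_index_polynomial D = 0%R.
Proof.
rewrite /B_index_polynomial big1 // => c _.
by rewrite Ind_virtual // expr0z subrr mul0rz.
Qed.
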